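(* Let $A$ be an integer matrix with columns $a_1,\ldots,a_n$, let $\mathcal{L}=\ker(A)\cap\mathbf{Z}^n$, and suppose that the lattice ideal $I_{\mathcal{L}}$ has codimension two (equivalently $\mathcal{L}$ has dimension 2) and $\mathcal{L}\cap\mathbf{N}^n=\{0\}$. If $\mathcal{P}_\tau$ is an embedded prime of $V_{\mathcal{L}}$, then $\mathrm{cone}\{a_i : i\in\tau\}$ is not a face of $\mathrm{cone}\{a_i : i=1,\ldots,n\}$. In particular, the irrelevant maximal ideal $\mathcal{P}_\emptyset=\langle x_1,\ldots,x_n\rangle$ is not an associated prime of $V_{\mathcal{L}}$.
   Context: $S=k[x_1,\ldots,x_n]$, $x^u=\prod_i x_i^{u_i}$. $I_{\mathcal{L}}=\langle x^u-x^v: u,v\in\mathbf{N}^n, u-v\in\mathcal{L}\rangle$. For $u\in\mathbf{N}^n$ the fiber is $P_u=\mathrm{conv}\{v\in\mathbf{N}^n: u-v\in\mathcal{L}\}$; the vertex ideal $V_{\mathcal{L}}$ is the monomial ideal spanned by monomials $x^v$ with $v$ not a vertex of $P_v$. For $\tau\subseteq\{1,\ldots,n\}$, $\mathcal{P}_\tau=\langle x_i : i\notin\tau\rangle$; all associated primes of the monomial ideal $V_{\mathcal{L}}$ are of this form. $\mathrm{cone}$ denotes the nonnegative real span. *)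

(* Defs.v *)
From HB Require Import structures.
From mathcomp Require Import all_boot all_order all_algebra.
From mathcomp Require Import classical_sets reals.
From mathcomp Require Import mpoly.

Set Implicit Arguments.
Unset Strict Implicit.
Unset Printing Implicit Defensive.

Import Order.TTheory GRing.Theory Num.Theory.
Local Open Scope classical_set_scope.
Local Open Scope ring_scope.

Section CommutativeAlgebra.
Variable T : comNzRingType.

Definition ideal_gen (G : set T) : set T :=
  [set p | exists (m : nat) (c g : 'I_m -> T),
     (forall i, G (g i)) /\ p = \sum_(i < m) c i * g i].

(* [idealr_closed] includes properness. *)
Definition prime_ideal (P : set T) : Prop :=
  idealr_closed (mem P) /\ prime_idealr_closed (mem P).

Definition colon (I : set T) (f : T) : set T := [set g | I (g * f)].

Definition associated_prime (I P : set T) : Prop :=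
  prime_ideal P /\ exists f : T, P = colon I f.

Definition embedded_prime (I P : set T) : Prop :=
  associated_prime I P /\ exists2 Q, associated_prime I Q & Q `<` P.

Definition prime_chain (P : set T) (h : nat) : Prop :=
  exists Q : nat -> set T,
    [/\ forall i, (i <= h)%N -> prime_ideal (Q i),
        forall i, (i < h)%N -> Q i `<` Q i.+1
      & Q h = P].

Definition height (P : set T) (h : nat) : Prop :=
  prime_chain P h /\ forall j, prime_chain P j -> (j <= h)%N.

(* The least height of a prime containing I; a prime of infinite height has
   chains of every length. *)
Definition codimension (I : set T) (c : nat) : Prop :=
  (exists P, [/\ prime_ideal P, I `<=` P & height P c]) /\
  (forall P, prime_ideal P -> I `<=` P -> prime_chain P c).

End CommutativeAlgebra.

Section ConvexGeometry.
Variable R : realType.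

Definition conv_hull d (X : set 'cV[R]_d) : set 'cV[R]_d :=
  [set p | exists (m : nat) (w : 'I_m -> R) (x : 'I_m -> 'cV[R]_d),
     [/\ forall i, X (x i), forall i, 0 <= w i,
         \sum_(i < m) w i = 1 & p = \sum_(i < m) w i *: x i]].

(* F is cut out of C by a valid linear inequality b <= c x; in particular C
   and the empty set are faces of C. *)
Definition is_face d (F C : set 'cV[R]_d) : Prop :=
  exists (c : 'rV[R]_d) (b : R),
    (forall x, C x -> b <= (c *m x) 0 0) /\
    F = [set x | C x /\ (c *m x) 0 0 = b].

Definition is_vertex d (x : 'cV[R]_d) (C : set 'cV[R]_d) : Prop :=
  is_face [set x] C.

Definition cone_of_columns d n (A : 'M[int]_(d, n)) (tau : {set 'I_n}) :
    set 'cV[R]_d :=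
  [set y | exists w : 'I_n -> R,
     (forall i, 0 <= w i) /\
     y = \sum_(i in tau) w i *: col i (map_mx intr A)].

End ConvexGeometry.
Arguments cone_of_columns R {d n} A tau _ : rename.

Section LatticeIdeals.
Variable n : nat.

Definition mnm_int (u : 'X_{1..n}) : 'cV[int]_n := \col_i (u i)%:Z.

Definition mnm_real (R : realType) (u : 'X_{1..n}) : 'cV[R]_n :=
  \col_i (u i)%:R.

Definition ker_lattice d (A : 'M[int]_(d, n)) : set 'cV[int]_n :=
  [set u | A *m u = 0].

Definition nonneg_orthant : set 'cV[int]_n := [set u | forall i, 0 <= u i 0].

Variable k : fieldType.

Definition lattice_ideal (L : set 'cV[int]_n) : set {mpoly k[n]} :=
  ideal_gen [set p | exists u v : 'X_{1..n},
     L (mnm_int u - mnm_int v) /\ p = 'X_[u] - 'X_[v]].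

Definition fiber (R : realType) (L : set 'cV[int]_n) (u : 'X_{1..n}) :
    set 'cV[R]_n :=
  conv_hull [set mnm_real R v | v in [set v | L (mnm_int u - mnm_int v)]].

Definition vertex_ideal (R : realType) (L : set 'cV[int]_n) :
    set {mpoly k[n]} :=
  ideal_gen [set p | exists v : 'X_{1..n},
     ~ is_vertex (mnm_real R v) (fiber L v) /\ p = 'X_[v]].

Definition coord_prime (tau : {set 'I_n}) : set {mpoly k[n]} :=
  ideal_gen [set 'X_i | i in [set i | i \notin tau]].

End LatticeIdeals.
Arguments lattice_ideal {n} k L _ : rename.
Arguments vertex_ideal {n} k R L _ : rename.
Arguments coord_prime {n} k tau _ : rename.
Arguments nonneg_orthant n _ : clear implicits.

(* Main.v *)
(* The codimension hypothesis is used through explicit chains of toric primes: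
   if L had rank at least 3, intersecting L with coordinate hyperplanes would
   give a chain that is too long below any prime containing I_L; if L had rank
   at most 1, I_L would be principal and have no chain of length 2 below it.
   Hence L = Z g + Z h.

   If P_tau is associated to V_L, some vertex w is such that every w + e_i with
   i outside tau is not a vertex. Identify L with Z^2, on which the coordinates
   i become linear forms b_i: the feasible z are those with b_i z >= - w_i for
   all i, and a functional om that exposes w is positive on the nonzero ones.
   Relaxing the constraint i by one yields p_i with om p_i < 0 and
   b_i p_i = - w_i - 1. Triangles 0, p_i, p_j contain no further lattice point,
   so that det (p_i, p_j) = 1 or -1; hence there are at most three indices
   outside tau and, if there are three, p_j = p_i + p_k for a suitable labelling.
   The functional x - 2 y in the basis (p_i, p_k) does not expose w + e_i, which
   forces b_k p_i <= w_k, and b_i p_k <= w_i by symmetry. So z = - p_j is an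
   element of L with z_i > 0 for all i outside tau.

   Every prime containing V_L contains two variables, because L has nonzero
   elements with any prescribed coordinate equal to zero; so an embedded P_tau
   has three indices outside tau. A functional c cutting out cone {a_i : i in tau}
   satisfies c A z = 0, so it kills all the a_i, and the a_j with j outside tau
   lie in the cone; this contradicts the linear dependence of the three b_j.
   For tau empty, z contradicts L /\ N^n = {0}. *)
From HB Require Import structures.
Require Import Defs.
From mathcomp Require Import all_boot all_order all_algebra.
From mathcomp Require Import classical_sets reals.
From mathcomp Require Import mpoly.
From mathcomp Require Import boolp.
From mathcomp Require Import zify ring lra.

Import Order.TTheory GRing.Theory Num.Theory.
Local Open Scope classical_set_scope.
Local Open Scope ring_scope.

Set Implicit Arguments.
Unset Strict Implicit.
Unset Printing Implicit Defensive.

(** * Toric ideals *)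

Section Ideals.
Variable T : comNzRingType.
Implicit Types (G P Q : set T).

Lemma ideal_gen_mem G g : G g -> ideal_gen G g.
Proof.
by move=> Gg; exists 1, (fun=> 1), (fun=> g); split=> //; rewrite big_ord1 mul1r.
Qed.

Lemma ideal_gen0 G : ideal_gen G 0.
Proof.
by exists 0, (fun=> 0), (fun=> 0); split; [case|rewrite big_ord0].
Qed.

Lemma ideal_genD G a u v : ideal_gen G u -> ideal_gen G v -> ideal_gen G (a * u + v).
Proof.
move=> [m [c [g [Gg ->]]]] [m' [c' [g' [Gg' ->]]]].
exists (m + m')%N, (fun i => match split i with inl j => a * c j | inr j => c' j end),
  (fun i => match split i with inl j => g j | inr j => g' j end).
split=> [i|]; first by case: split.
rewrite big_split_ord mulr_sumr /=; congr (_ + _); apply: eq_bigr => i _.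
  by rewrite (unsplitK (inl i)) mulrA.
by rewrite (unsplitK (inr i)).
Qed.

Lemma prime_ideal0 P : prime_ideal P -> P 0.
Proof. by move=> [[]]; rewrite in_setE. Qed.

Lemma prime_ideal1 P : prime_ideal P -> ~ P 1.
Proof. by move=> [[_ /negP + _] _]; rewrite in_setE. Qed.

Lemma prime_idealD P a u v : prime_ideal P -> P u -> P v -> P (a * u + v).
Proof.
by move=> [[_ _ h] _] Pu Pv; rewrite -in_setE; apply: h; rewrite in_setE.
Qed.

Lemma prime_idealM P u v : prime_ideal P -> P (u * v) -> P u \/ P v.
Proof.
by move=> [_ h]; rewrite -in_setE => /h /orP[]; rewrite in_setE; [left|right].
Qed.

Lemma ideal_gen_sub G P : prime_ideal P -> G `<=` P -> ideal_gen G `<=` P.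
Proof.
move=> hP GP p [m [c [g [Gg ->]]]]; elim/big_rec: _ => [|i x _ Px].
  exact: prime_ideal0.
by apply: prime_idealD => //; apply: GP.
Qed.

Lemma prime_ideal_prod P (I : Type) (s : seq I) (F : I -> T) :
  prime_ideal P -> P (\prod_(i <- s) F i) -> exists i, P (F i).
Proof.
move=> hP; elim: s => [|i s ih]; first by rewrite big_nil => /(prime_ideal1 hP).
by rewrite big_cons => /(prime_idealM hP)[Pi|/ih//]; exists i.
Qed.

Lemma prime_ideal_exp P x m : prime_ideal P -> P (x ^+ m) -> P x /\ m <> 0%N.
Proof.
move=> hP; elim: m => [|m ih]; first by rewrite expr0 => /(prime_ideal1 hP).
by rewrite exprS => /(prime_idealM hP)[|/ih[]].
Qed.

Lemma kernel_prime (K : fieldType) (f : {rmorphism T -> K}) :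
  prime_ideal [set p | f p = 0].
Proof.
split; [split|].
- by rewrite in_setE /= rmorph0.
- by apply/negP; rewrite in_setE /= rmorph1 => /eqP; rewrite oner_eq0.
- move=> a u v; rewrite !in_setE /= => fu fv.
  by rewrite rmorphD rmorphM fu fv mulr0 addr0.
- move=> u v; rewrite !in_setE /= rmorphM => /eqP; rewrite mulf_eq0.
  by case/orP=> /eqP h; apply/orP; [left|right]; rewrite in_setE.
Qed.

Lemma prime_chain0 P : prime_ideal P -> prime_chain P 0.
Proof. by move=> hP; exists (fun=> P); split. Qed.

Lemma prime_chainS P Q m : prime_ideal P -> Q `<` P -> prime_chain Q m ->
  prime_chain P m.+1.
Proof.
move=> hP QP [C [C1 C2 C3]]; exists (fun i => if (i <= m)%N then C i else P).
split=> [i _|i|]; last by rewrite ltnn.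
  by case: ifP => // im; apply: C1.
rewrite ltnS => im; rewrite im; have [im1|] := ltnP i m; first exact: C2.
move=> h; have mi : m = i by apply/eqP; rewrite eqn_leq h im.
by rewrite -mi C3.
Qed.

End Ideals.

Lemma pos_sub_neg (x : int) :
  (absz (Num.max x 0))%:Z - (absz (Num.max (- x) 0))%:Z = x.
Proof. by lia. Qed.

(** * The lattice ideal as the kernel of a map into a field *)

Section Toric.
Variables (k : fieldType) (d n : nat) (A : 'M[int]_(d, n)).
Variables (K : fieldType) (F : {rmorphism {mpoly k[d]} -> K}).
Hypothesis F_inj : injective F.

(* x_j is sent to t^{a_j}, where a_j^+ and a_j^- are the positive and negative
   parts of the column a_j. *)
Let posm j : 'X_{1..d} := [multinom absz (Num.max (A i j) 0) | i < d].
Let negm j : 'X_{1..d} := [multinom absz (Num.max (- A i j) 0) | i < d].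
Let posw (m : 'X_{1..n}) : 'X_{1..d} := (\sum_j (posm j *+ m j))%MM.
Let negw (m : 'X_{1..n}) : 'X_{1..d} := (\sum_j (negm j *+ m j))%MM.

Definition toric_map : {mpoly k[n]} -> K :=
  mmap (F \o @mpolyC d k)
    (fun j => F 'X_[posm j] / F 'X_[negm j]).
HB.instance Definition _ := GRing.RMorphism.on toric_map.

Let F_X_neq0 (m : 'X_{1..d}) : F 'X_[m] != 0.
Proof. by rewrite raddf_eq0 // -msupp_eq0 msuppX. Qed.

(** The vector [A m] is the difference of [posw m] and [negw m]; moving negative parts across keeps
    all exponents natural. *)
Let weight_eq (u v : 'X_{1..n}) :
  (posw u + negw v)%MM = (posw v + negw u)%MM <-> A *m mnm_int u = A *m mnm_int v.
Proof.
have E (i : 'I_d) (m : 'X_{1..n}) :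
    (posw m i)%:Z - (negw m i)%:Z = (A *m mnm_int m) i 0.
  rewrite /posw /negw !mnm_sumE !(big_morph Posz PoszD (erefl 0%:Z)) -sumrB mxE; apply: eq_bigr => j _.
  rewrite !mulmnE !mnmE mxE !PoszM -mulrBl; congr (_ * _).
  by rewrite pos_sub_neg.
split=> [/mnmP h|/colP h].
  by apply/colP => i; rewrite -!E; have := h i; rewrite !mnmDE; lia.
by apply/mnmP => i; have := h i; rewrite -!E !mnmDE; lia.
Qed.

Lemma toric_mapX (m : 'X_{1..n}) : toric_map 'X_[m] = F 'X_[posw m] / F 'X_[negw m].
Proof.
rewrite /toric_map mmapX /mmap1 /posw /negw -!mprodXnE !rmorph_prod -prodfV -big_split.
by apply: eq_bigr => j _; rewrite /= !rmorphXn /= exprMn exprVn.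
Qed.

Lemma toric_map_binomial (u v : 'X_{1..n}) :
  toric_map 'X_[u] = toric_map 'X_[v] <-> A *m mnm_int u = A *m mnm_int v.
Proof.
rewrite -weight_eq !toric_mapX; split=> [/eqP|h].
  rewrite eqr_div // -!(rmorphM F) -!mpolyXD => /eqP /F_inj /(congr1 (@mlead _ _)).
  by rewrite !mleadXm.
by apply/eqP; rewrite eqr_div // -!(rmorphM F) -!mpolyXD h.
Qed.

(* Clearing denominators turns [toric_map p = 0] into a polynomial identity, in
   which the monomial coming from u must cancel against another one. *)
Lemma toric_kernel_partner (p : {mpoly k[n]}) (u : 'X_{1..n}) :
  toric_map p = 0 -> u \in msupp p ->
  exists v, [/\ v \in msupp p, v != u & A *m mnm_int v = A *m mnm_int u].
Proof.
move=> p0 up; pose N : 'X_{1..d} := (\sum_(m <- msupp p) negw m)%MM.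
have negN m : m \in msupp p -> (negw m <= N)%MM.
  by move=> mp; rewrite /N (big_rem m) //= lem_addr.
pose e m : 'X_{1..d} := (posw m + (N - negw m))%MM.
have e_eq m m' : m \in msupp p -> m' \in msupp p -> e m = e m' ->
    A *m mnm_int m = A *m mnm_int m'.
  move=> mp m'p /mnmP h; apply/weight_eq/mnmP => i; have := h i.
  rewrite /e !mnmDE !mnmBE.
  by have /mnm_lepP/(_ i) := negN _ mp; have /mnm_lepP/(_ i) := negN _ m'p; lia.
have : \sum_(m <- msupp p) p@_m *: 'X_[e m] = 0 :> {mpoly k[d]}.
  apply: F_inj; rewrite rmorph0 rmorph_sum /=.
  transitivity (toric_map p * F 'X_[N]); last by rewrite p0 mul0r.
  rewrite [in RHS](mpolyE p) rmorph_sum mulr_suml big_seq [RHS]big_seq.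
  apply: eq_bigr => m mp; rewrite /= -!mul_mpolyC !rmorphM /= toric_mapX.
  rewrite -(submK (negN m mp)) mpolyXD [in RHS]rmorphM /=.
  have -> : toric_map (p@_m)%:MP = F (p@_m)%:MP.
    by rewrite /toric_map mmapC.
  rewrite /e mpolyXD rmorphM /= -!mulrA; congr (_ * (_ * _)).
  by rewrite [RHS]mulrCA mulVf ?mulr1.
move=> /(congr1 (mcoeff (e u))); rewrite mcoeff0 raddf_sum (big_rem u) //=.
rewrite mcoeffZ mcoeffX eqxx mulr1 => h.
have [/hasP[v vp /eqP ev]|/hasPn no] := boolP (has (fun m => e m == e u) (rem u (msupp p))).
  move: vp; rewrite (rem_filter _ (msupp_uniq p)) mem_filter => /andP[/= vu vp].
  by exists v; split=> //; apply: e_eq.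
move: h; rewrite big_seq big1 => [/eqP|m mp]; last first.
  by rewrite mcoeffZ mcoeffX (negPf (no m mp)) mulr0.
by rewrite addr0 mcoeff_eq0 up.
Qed.

(** Kernel elements are reduced by binomials: the leading monomial is cancelled against a partner
    [v] already in the support, so the number of terms drops. *)
Lemma lattice_ideal_kernel :
  lattice_ideal k (ker_lattice A) = [set p | toric_map p = 0].
Proof.
apply/seteqP; split=> p.
  apply: ideal_gen_sub (kernel_prime toric_map) _ _ => _ [u [v [uv ->]]] /=.
  apply/eqP; rewrite rmorphB subr_eq0; apply/eqP/toric_map_binomial/eqP.
  by rewrite -subr_eq0 -mulmxBr; apply/eqP.
have [s] := ubnP (size (msupp p)); elim: s p => // s ih p ps /= p0.
have [->|pn0] := eqVneq p 0; first exact: ideal_gen0.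
have up := mlead_supp pn0; have [v [vp vu Avu]] := toric_kernel_partner p0 up.
pose b : {mpoly k[n]} := 'X_[mlead p] - 'X_[v].
have -> : p = (p@_(mlead p))%:MP * b + (p - (p@_(mlead p))%:MP * b) by ring.
have b0 : toric_map b = 0.
  by apply/eqP; rewrite rmorphB subr_eq0; apply/eqP/toric_map_binomial.
apply: ideal_genD.
  apply: ideal_gen_mem; exists (mlead p), v; split=> //.
  by rewrite /ker_lattice /= mulmxBr Avu subrr.
apply: ih; last by rewrite /= rmorphB rmorphM /= b0 mulr0 subr0.
rewrite -ltnS (leq_trans _ ps) // ltnS (leq_ltn_trans (n := size (rem (mlead p) (msupp p)))) //.
  apply: uniq_leq_size => // m; rewrite mcoeff_msupp mcoeffB mul_mpolyC mcoeffZ.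
  rewrite mcoeffB !mcoeffX (rem_filter _ (msupp_uniq p)) mem_filter /=.
  have [<-|um] := eqVneq (mlead p) m; first by rewrite (negPf vu) subr0 mulr1 subrr eqxx.
  have [<- //|vm] := eqVneq v m.
  by rewrite subrr mulr0 subr0 mcoeff_msupp.
by rewrite size_rem // prednK // lt0n size_eq0 msupp_eq0.
Qed.

End Toric.

Section ToricIdeals.
Variables (k : fieldType) (d n : nat) (A : 'M[int]_(d, n)).

Lemma mpoly_embeds_in_field :
  exists (K : fieldType) (F : {rmorphism {mpoly k[d]} -> K}), injective F.
Proof.
pose T : idomainType := {mpoly k[d]}.
exists {fraction T}, (@FracField.tofrac T).
by move=> x y /eqP; rewrite tofrac_eq => /eqP.
Qed.

Lemma lattice_ideal_prime : prime_ideal (lattice_ideal k (ker_lattice A)).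
Proof.
have [K [F F_inj]] := mpoly_embeds_in_field.
by rewrite (lattice_ideal_kernel A F_inj); apply: kernel_prime.
Qed.

Lemma lattice_ideal_binomial (u v : 'X_{1..n}) :
  lattice_ideal k (ker_lattice A) ('X_[u] - 'X_[v]) -> ker_lattice A (mnm_int u - mnm_int v).
Proof.
have [K [F F_inj]] := mpoly_embeds_in_field.
rewrite (lattice_ideal_kernel A F_inj) /= rmorphB => /eqP; rewrite subr_eq0 => /eqP.
by move=> /(toric_map_binomial A F_inj); rewrite /ker_lattice /= mulmxBr => ->; rewrite subrr.
Qed.

End ToricIdeals.

(** * The rank of the lattice *)

Section Rank.
Variable n : nat.
Implicit Types (L : set 'cV[int]_n) (u v g : 'cV[int]_n) (S : {set 'I_n}).

(** For a lattice this says that the rank is at least r. Vanishing coordinates serve both the prime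
    chains, which drop one coordinate at a time, and the choice of elements with a prescribed
    zero. *)
Definition rank_ge L (r : nat) := forall S, (#|S| < r)%N ->
  exists u, [/\ L u, u <> 0 & forall i, i \in S -> u i 0 = 0].

Definition lattice L := L 0 /\ forall u v, L u -> L v -> L (u - v).

Lemma ker_lattice_lattice d (A : 'M[int]_(d, n)) : lattice (ker_lattice A).
Proof.
split=> [|u v]; rewrite /ker_lattice /= ?mulmx0 // => Au Av.
by rewrite mulmxBr Au Av subrr.
Qed.

Lemma latticeN L u : lattice L -> L u -> L (- u).
Proof. by move=> [L0 LB] Lu; rewrite -sub0r; apply: LB. Qed.

Lemma latticeD L u v : lattice L -> L u -> L v -> L (u + v).
Proof.
by move=> hL Lu Lv; rewrite -[v]opprK; apply: hL.2 => //; apply: latticeN.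
Qed.

Lemma latticeZ L u m : lattice L -> L u -> L (m *: u).
Proof.
move=> hL Lu; have Ln l : L (l%:Z *: u).
  elim: l => [|l ih]; first by rewrite scale0r; case: hL.
  by rewrite intS scalerDl scale1r; apply: latticeD.
case: (intP m) => [|l|l]; first exact: (Ln 0).
  exact: Ln.
by rewrite scaleNr; apply: latticeN.
Qed.

(** Take g with the least nonzero absolute value in coordinate i; a nonzero remainder modulo it
    would be smaller. *)
Lemma coordinate_division L i : lattice L ->
  exists2 g, L g & forall u, L u -> exists m, (u - m *: g) i 0 = 0.
Proof.
move=> hL; have [L0 LB] := hL.
have [[u0 [Lu0 u0i]]|none] := pselect (exists u, L u /\ u i 0 <> 0); last first.
  exists 0 => // u Lu; exists 0; rewrite scale0r subr0.
  by apply: contrapT => ui; apply: none; exists u.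
pose P l := `[< exists u, L u /\ absz (u i 0) = l.+1 >].
have exP : exists l, P l.
  by exists (absz (u0 i 0)).-1; apply/asboolP; exists u0; split=> //; lia.
case: (ex_minnP exP) => l /asboolP[g [Lg gi]] lmin.
exists g => // u Lu; exists (divz (u i 0) (g i 0)); rewrite !mxE.
have rE : u i 0 - divz (u i 0) (g i 0) * g i 0 = modz (u i 0) (g i 0).
  by rewrite {1}(divz_eq (u i 0) (g i 0)); ring.
rewrite rE; apply: contrapT => r0.
have g0 : g i 0 != 0 by lia.
have r1 := modz_ge0 (u i 0) g0; have r2 := ltz_mod (u i 0) g0.
have : P (absz (modz (u i 0) (g i 0))).-1.
  apply/asboolP; exists (u - divz (u i 0) (g i 0) *: g); split.
    by apply: LB => //; apply: latticeZ.
  rewrite !mxE rE; lia.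
move/lmin; lia.
Qed.

(** Split off the generator given by [coordinate_division] at the first coordinate and recurse into
    the sublattice where that coordinate vanishes. Generators may be zero. *)
Lemma lattice_generators (s : seq 'I_n) L : lattice L ->
  (forall u, L u -> (forall i, i \in s -> u i 0 = 0) -> u = 0) ->
  exists gs : seq 'cV[int]_n, [/\ size gs = size s, forall g, g \in gs -> L g &
    forall u, L u -> exists c : nat -> int, u = \sum_(j < size gs) c j *: gs`_j].
Proof.
elim: s L => [|i s ih] L hL Ls.
  exists [::]; split=> // u Lu; exists (fun=> 0); rewrite big_ord0.
  exact: Ls.
have [L0 LB] := hL; have [g Lg gdiv] := coordinate_division i hL.
have [|u [Lu ui] us|gs [gss gsL gsu]] := ih (fun u => L u /\ u i 0 = 0).
- split=> [|u v [Lu ui] [Lv vi]]; first by rewrite mxE.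
  by split; [apply: LB|rewrite !mxE ui vi subrr].
- by apply: Ls => // j; rewrite inE => /predU1P[->//|/us].
exists (g :: gs); split=> /= [|h|u Lu]; first by rewrite gss.
  by rewrite inE => /predU1P[->//|/gsL[]].
have [m um] := gdiv u Lu.
have [|c cE] := gsu (u - m *: g); first by split=> //; apply: LB => //; apply: latticeZ.
exists (fun j => if j is j'.+1 then c j' else m).
by rewrite big_ord_recl /= -cE addrC subrK.
Qed.

Lemma not_rank_ge L r : ~ rank_ge L r -> exists2 S : {set 'I_n}, (#|S| < r)%N &
  forall u, L u -> (forall i, i \in S -> u i 0 = 0) -> u = 0.
Proof.
move=> h; apply: contrapT => no; apply: h => S Sr; apply: contrapT => no'.
apply: no; exists S => // u Lu uS; apply: contrapT => u0; apply: no'.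
by exists u.
Qed.

Lemma rank_le1_generator L : lattice L -> ~ rank_ge L 2 ->
  exists2 g, L g & forall u, L u -> exists m, u = m *: g.
Proof.
move=> hL /not_rank_ge[S S2 hS]; have [L0 _] := hL.
have [|[|g gs] [gss gsL gsu]] := @lattice_generators (enum S) L hL.
- by move=> u Lu us; apply: hS => // i iS; apply: us; rewrite mem_enum.
- exists 0 => // u /gsu[c ->]; exists 0; by rewrite big_ord0 scale0r.
have gs0 : gs = [::] by apply: size0nil; move: gss S2; rewrite cardE => <- /=; lia.
move: gsL gsu; rewrite {}gs0 => gsL gsu.
exists g => [|u /gsu[c ->]]; first by apply: gsL; rewrite inE.
by exists (c 0); rewrite big_ord1.
Qed.

Lemma scale_int_eq0 (x : int) u : x != 0 -> x *: u = 0 -> u = 0.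
Proof.
move=> x0 /colP xu; apply/colP => i; move/eqP: (xu i).
by rewrite !mxE mulf_eq0 (negPf x0) => /eqP.
Qed.

Lemma rank2_basis L : lattice L -> rank_ge L 2 -> ~ rank_ge L 3 ->
  exists g h, [/\ L g, L h, forall u, L u -> exists x y, u = x *: g + y *: h &
    forall x y, x *: g + y *: h = 0 -> x = 0 /\ y = 0].
Proof.
move=> hL r2 /not_rank_ge[S S2 hS]; have [L0 _] := hL.
have [g [h [Lg Lh gen]]] : exists g h, [/\ L g, L h &
    forall u, L u -> exists x y, u = x *: g + y *: h].
  have [|gs [gss gsL gsu]] := @lattice_generators (enum S) L hL.
    by move=> u Lu us; apply: hS => // i iS; apply: us; rewrite mem_enum.
  have {}gss : (size gs <= 2)%N by rewrite gss -cardE.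
  have gsn j : L gs`_j.
    by have [jl|jl] := ltnP j (size gs); [apply/gsL/mem_nth|rewrite nth_default].
  (* The default value 0 fills in when [gs] is shorter than two. *)
  exists gs`_0, gs`_1; split=> // u /gsu[c ->].
  have -> : \sum_(j < size gs) c j *: gs`_j = \sum_(j < 2) c j *: gs`_j.
    rewrite (big_ord_widen _ (fun j => c j *: gs`_j) gss) [RHS](bigID (fun j : 'I_2 => (j < size gs)%N)) /=.
    by rewrite [X in _ = _ + X]big1 ?addr0 // => j; rewrite -leqNgt => jl; rewrite nth_default ?scaler0.
  by exists (c 0), (c 1); rewrite big_ord_recl big_ord1.
exists g, h; split=> //.
(* If x is nonzero, [x *: u] is a multiple of q for every u in L. Some nonzero u vanishes at a
   coordinate where q does not, which forces the multiple to be 0. *)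
have key x y (p q : 'cV[int]_n) : (forall u, L u -> exists a b, u = a *: p + b *: q) ->
    x *: p + y *: q = 0 -> x = 0.
  move=> genpq e; apply/eqP/negPn/negP => x0.
  have mult u : L u -> exists c, x *: u = c *: q.
    move=> /genpq[a [b ->]]; exists (x * b - a * y).
    transitivity (a *: (x *: p + y *: q) + (x * b - a * y) *: q).
      by apply/matrixP => i j; rewrite !mxE; ring.
    by rewrite e scaler0 add0r.
  have [q0|/eqP/matrix0Pn[i [j qi]]] := pselect (q = 0).
    have [|u [Lu u0 _]] := r2 finset.set0; first by rewrite cards0.
    by have [c] := mult u Lu; rewrite q0 scaler0 => /(scale_int_eq0 x0).
  rewrite (ord1 j) in qi.
  have [|u [Lu u0 ui]] := r2 [set i]%SET; first by rewrite cards1.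
  have [c cE] := mult u Lu; move: (cE) => /matrixP/(_ i 0).
  rewrite !mxE ui ?inE // mulr0 => /esym/eqP; rewrite mulf_eq0 (negPf qi) orbF => /eqP c0.
  by move: cE; rewrite c0 scale0r => /(scale_int_eq0 x0).
move=> x y e; split; first exact: key gen e.
apply: (key y x h g); last by rewrite addrC.
by move=> u /gen[a [b ->]]; exists b, a; rewrite addrC.
Qed.

Lemma mnm_int_sub u : exists p q : 'X_{1..n},
  [/\ mnm_int p - mnm_int q = u, forall i, (p i)%:Z = Num.max (u i 0) 0 &
      forall i, (q i)%:Z = Num.max (- u i 0) 0].
Proof.
exists [multinom absz (Num.max (u i 0) 0)%R | i < n], [multinom absz (Num.max (- u i 0) 0)%R | i < n].
split=> [|i|i]; last by rewrite mnmE; lia.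
  by apply/colP => i; rewrite !mxE !mnmE pos_sub_neg.
by rewrite mnmE; lia.
Qed.

End Rank.

(** * From codimension two to rank two *)

Section Codimension.
Variables (k : fieldType) (n : nat).

(** Appending to A the row that reads coordinate i restricts the kernel to [u i 0 = 0]. The ideal
    becomes a strictly smaller prime, and the rank drops by at most one. *)
Lemma rank_ge_chain r d (A : 'M[int]_(d, n)) :
  rank_ge (ker_lattice A) r -> prime_chain (lattice_ideal k (ker_lattice A)) r.
Proof.
elim: r d A => [|r ih] d A hr; first exact/prime_chain0/lattice_ideal_prime.
have [|u [Au u0 _]] := hr finset.set0; first by rewrite cards0.
have /matrix0Pn[i [j ui]] : u != 0 by apply/eqP.
rewrite (ord1 j) {j} in ui.
pose A' := col_mx A (delta_mx 0 i : 'rV[int]_n).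
have A'P v : ker_lattice A' v <-> ker_lattice A v /\ v i 0 = 0.
  rewrite /ker_lattice /= /A' mul_col_mx -rowE; split=> [/eqP|[-> vi]].
    rewrite col_mx_eq0 => /andP[/eqP ? /eqP /matrixP/(_ 0 0)].
    by rewrite !mxE.
  apply/eqP; rewrite col_mx_eq0 eqxx; apply/eqP/matrixP => a b.
  by rewrite !mxE (ord1 b).
apply: (@prime_chainS _ _ (lattice_ideal k (ker_lattice A'))).
- exact: lattice_ideal_prime.
- split=> [|sub].
    apply: ideal_gen_sub; first exact: lattice_ideal_prime.
    move=> p [v [w [/A'P[vw _] ->]]]; apply: ideal_gen_mem.
    by exists v, w.
  have [p [q [pq _ _]]] := mnm_int_sub u.
  have /sub : lattice_ideal k (ker_lattice A) ('X_[p] - 'X_[q]).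
    by apply: ideal_gen_mem; exists p, q; rewrite pq.
  by move=> /lattice_ideal_binomial /A'P[_ /eqP]; rewrite pq (negPf ui).
apply: ih => S Sr; have [|v [Av v0 vS]] := hr (i |: S)%SET.
  by rewrite cardsU1 (leq_ltn_trans (leq_add (leq_b1 _) (leqnn _))).
exists v; split=> // [|l lS]; last by apply: vS; rewrite !inE lS orbT.
by apply/A'P; split=> //; apply: vS; rewrite !inE eqxx.
Qed.

Section CyclicLattice.
Variables (d : nat) (A : 'M[int]_(d, n)) (g : 'cV[int]_n).
Hypothesis Ag : ker_lattice A g.
Hypothesis gen : forall u, ker_lattice A u -> exists m, u = m *: g.

(** With g = p - q split into positive and negative parts, trading a factor ['X_[p]] for ['X_[q]]
    moves the exponent by - g and changes the binomial by a multiple of b; repeat m times. *)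
Lemma cyclic_lattice_ideal_principal :
  exists2 b, lattice_ideal k (ker_lattice A) b &
  forall p, lattice_ideal k (ker_lattice A) p -> exists q, p = q * b.
Proof.
have [p [q [pq pE qE]]] := mnm_int_sub g.
pose b : {mpoly k[n]} := 'X_[p] - 'X_[q].
have pos m (u v : 'X_{1..n}) : mnm_int u - mnm_int v = m%:Z *: g ->
    exists c, 'X_[u] - 'X_[v] = c * b.
  elim: m u => [|m ih] u uv.
    exists 0; rewrite mul0r; apply/eqP; rewrite subr_eq0; apply/eqP; congr 'X_[_].
    apply/mnmP => i; move/colP/(_ i): uv; rewrite scale0r !mxE; lia.
  (* Where g is positive, u = v + (m + 1) g is at least g. *)
  have pu : (p <= u)%MM.
    apply/mnm_lepP => i; move/colP/(_ i): uv; rewrite !mxE -lez_nat pE.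
    rewrite ge_max andbT; move: (g i 0 : int) (u i) (v i) => x a c e.
    have : 0 <= m%:Z * x \/ x <= 0 by nia.
    by move: e; rewrite intS mulrDl mul1r; lia.
  have [|c cE] := ih (u - p + q)%MM.
    apply/colP => i; move/colP/(_ i): uv; move/mnm_lepP/(_ i): pu.
    move/colP/(_ i): pq; rewrite !mxE mnmDE mnmBE intS mulrDl mul1r => <-.
    move: (m%:Z * _) => y; lia.
  exists ('X_[u - p] + c); rewrite mulrDl -cE /b mulrBr -!mpolyXD submK //.
  by ring.
exists b; first by apply: ideal_gen_mem; exists p, q; rewrite pq.
move=> f [m [c [x [hx ->]]]].
have /choice[y hy] : forall i, exists y, x i = y * b.
  move=> i; have [u [v [uv ->]]] := hx i; have [l lE] := gen uv.
  case: (intP l) lE => [|l'|l'] lE; [exact: (pos 0)|exact: (pos l'.+1)|].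
  have [|e eE] := pos l'.+1 v u; last by exists (- e); rewrite mulNr -eE opprB.
  by rewrite -opprB lE scaleNr opprK.
by exists (\sum_(i < m) c i * y i); rewrite mulr_suml; apply: eq_bigr => i _; rewrite hy mulrA.
Qed.

(** A prime [Q 1] strictly inside the principal ideal of b misses b, so an element [q * b] of it has
    q in [Q 1], of smaller degree. Descent gives [Q 1] = 0, which leaves no room for [Q 0]. *)
Lemma cyclic_lattice_no_chain : ~ prime_chain (lattice_ideal k (ker_lattice A)) 2.
Proof.
have [b Ib Iq] := cyclic_lattice_ideal_principal.
have hI := lattice_ideal_prime k A.
move=> [Q [Q1 Q2 Q3]]; have h1 : prime_ideal (Q 1) by apply: Q1.
have [s10 n01] := Q2 0 isT; have [s12 n12] := Q2 1 isT; rewrite Q3 in s12 n12.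
have b1 : ~ Q 1 b.
  move=> Qb; apply: n12 => p /Iq[q ->].
  by rewrite -[q * b]addr0; apply: prime_idealD => //; apply: prime_ideal0.
apply: n01 => p Qp; suff -> : p = 0 by apply: prime_ideal0; apply: Q1.
have [s] := ubnP (msize p); elim: s p Qp => // s ih p Qp ps.
have [q pE] := Iq _ (s12 _ Qp).
have [q0|q0] := eqVneq q 0; first by rewrite pE q0 mul0r.
have [b0|b0] := eqVneq b 0; first by rewrite pE b0 mulr0.
have bs : (1 < msize b)%N.
  rewrite ltn_neqAle lt0n msize_poly_eq0 b0 andbT eq_sym.
  apply/negP => /msize_poly1P[c c0 bE]; apply: (prime_ideal1 hI).
  have -> : 1 = c^-1%:MP * b + 0 by rewrite addr0 bE -mpolyCM mulVf.
  by apply: prime_idealD => //; apply: prime_ideal0.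
have Qq : Q 1 q by have := Qp; rewrite pE => /(prime_idealM h1)[].
have q00 : q = 0.
  apply: ih => //; move: ps; rewrite pE msizeM //.
  by move: (msize q) (msize b) bs => x y; lia.
by rewrite pE q00 mul0r.
Qed.

End CyclicLattice.

(** The lower bound on chains, taken at the prime I itself, excludes rank at most 1. In rank 3 a
    chain of length 3 ends at I; it, or its extension to a larger P, contradicts height 2. *)
Lemma codimension2_rank d (A : 'M[int]_(d, n)) :
  codimension (lattice_ideal k (ker_lattice A)) 2 ->
  rank_ge (ker_lattice A) 2 /\ ~ rank_ge (ker_lattice A) 3.
Proof.
set I := lattice_ideal _ _; have hI : prime_ideal I := lattice_ideal_prime k A.
move=> [[P [hP IP [_ Pmax]]] ge2]; split.
  apply: contrapT => /(rank_le1_generator (ker_lattice_lattice A))[g Ag gen].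
  by apply: (cyclic_lattice_no_chain Ag gen); apply: ge2.
move=> /rank_ge_chain c3.
have [PI|PI] := pselect (P `<=` I).
  have PE : P = I by apply/seteqP.
  by have := Pmax 3; rewrite PE => /(_ c3).
by have := Pmax 4 (prime_chainS hP (conj IP PI) c3).
Qed.

End Codimension.

(** * Lattice points of the plane *)

Lemma sqrt2_irrational (R : rcfType) (x y : int) :
  x%:~R = Num.sqrt 2 * y%:~R :> R -> x = 0 /\ y = 0.
Proof.
move=> h.
have {}h : x ^+ 2 = 2 * y ^+ 2.
  apply: (@intr_inj R); rewrite rmorphXn /= h exprMn sqr_sqrtr ?ler0n //.
  by rewrite rmorphM rmorphXn.
have {}h : (`|x| ^ 2 = 2 * `|y| ^ 2)%N by lia.
have [y0|y0] := posnP `|y|%N.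
  by move: h; rewrite y0; move: y0; nia.
have x0 : (0 < `|x|)%N by nia.
move/(congr1 (fun m => odd (logn 2 m))): h.
by rewrite lognM ?expn_gt0 ?y0 // !lognX oddD !oddM.
Qed.

Section Planar.
Variables (R : realType) (I : finType) (a b w : I -> int).
Hypothesis w_ge0 : forall i, 0 <= w i.
Implicit Types (z p q : int * int).

(** A point z stands for the lattice element z.1 g + z.2 h, where a and b list the entries of g and
    h. *)
Definition row_form i z : int := a i * z.1 + b i * z.2.
Definition functional (c : R * R) z : R := c.1 * z.1%:~R + c.2 * z.2%:~R.
Definition pdet p q : int := p.1 * q.2 - p.2 * q.1.

Definition feasible (v : I -> int) z := forall i, - v i <= row_form i z.

Definition origin_exposed v :=
  exists c, forall z, feasible v z -> z <> (0, 0) -> 0 < functional c z.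

Definition relax i : I -> int := fun k => w k + (k == i)%:Z.

(* If an exposing functional vanishes on an integer vector z0, then neither z0
   nor - z0 is feasible; this bounds the feasible set in the direction of z0, so
   that a small perturbation with irrational slope is still exposing. *)
Lemma generic_exposing : origin_exposed w ->
  exists c, (forall z, feasible w z -> z <> (0, 0) -> 0 < functional c z) /\
    (forall z, functional c z = 0 -> z = (0, 0)).
Proof.
move=> [c hc].
have [[z0 [z0n0 cz0]]|no0] :=
  pselect (exists z, z <> (0, 0) /\ functional c z = 0); last first.
  exists c; split=> // z cz; apply: contrapT => zn0.
  by apply: no0; exists z.
have [l hl] : exists l : R, c = (- l * z0.2%:~R, l * z0.1%:~R).
  have n0 : (z0.1%:~R ^+ 2 + z0.2%:~R ^+ 2 : R) != 0.
    apply/eqP => /eqP; rewrite paddr_eq0 ?sqr_ge0 // !sqrf_eq0 !intr_eq0.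
    by case/andP=> /eqP h1 /eqP h2; apply: z0n0; case: (z0) h1 h2 => /= ? ? -> ->.
  exists ((c.2 * z0.1%:~R - c.1 * z0.2%:~R) / (z0.1%:~R ^+ 2 + z0.2%:~R ^+ 2)).
  move: cz0 n0; rewrite /functional; case: (c) => c1 c2 /= cz0 n0.
  have h1 : z0.1%:~R * (c1 * z0.1%:~R + c2 * z0.2%:~R) = 0 by rewrite cz0 mulr0.
  have h2 : z0.2%:~R * (c1 * z0.1%:~R + c2 * z0.2%:~R) = 0 by rewrite cz0 mulr0.
  congr pair; apply/eqP; rewrite -subr_eq0; apply/eqP; apply: (mulIf n0);
    rewrite mul0r; [rewrite -h1|rewrite -h2]; by field.
(* As c vanishes on z0, it is a multiple of [pdet z0]; the sign of z0 is chosen so that [pdet z0]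
   itself is exposing. *)
have {c hc cz0 z0n0 hl} [{}z0 z0n0 hz0] : exists2 z0, z0 <> (0, 0) &
    forall z, feasible w z -> z <> (0, 0) -> 0 < pdet z0 z.
  have cE z : functional c z = l * (pdet z0 z)%:~R.
    by rewrite hl /functional /pdet /= rmorphB !rmorphM /=; ring.
  have [l0|l0] := lerP 0 l.
    exists z0 => // z hz zn0; move: (hc _ hz zn0); rewrite cE => lz.
    rewrite -(ltr0z R) ltNge; apply/negP => pz.
    by move: lz; rewrite ltNge mulr_ge0_le0.
  exists (- z0.1, - z0.2) => [|z hz zn0].
    by case: (z0) z0n0 => x y n0 [] /eqP + /eqP; rewrite !oppr_eq0 => /eqP ? /eqP ?;
      apply: n0; congr pair.
  have := hc _ hz zn0; rewrite cE -mulrNN -rmorphN /= pmulr_rgt0 ?oppr_gt0 //.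
  by rewrite ltr0z /pdet /=; lia.
(* [pdet z0] vanishes on z0 and on its opposite, so neither is feasible: some constraint i fails at
   z0 and some j at - z0. *)
have [i hi] : exists i, row_form i z0 < - w i.
  apply: contrapT => /forallNP h; have /hz0 : feasible w z0.
    by move=> i; have /negP := h i; rewrite -leNgt.
  by move=> /(_ z0n0); rewrite /pdet mulrC subrr ltxx.
have [j hj] : exists j, w j < row_form j z0.
  apply: contrapT => /forallNP h; have /hz0 : feasible w (- z0.1, - z0.2).
    move=> k; have /negP := h k; rewrite -leNgt /row_form /=; lia.
  have n0 : (- z0.1, - z0.2) <> (0, 0).
    by case: (z0) z0n0 => x y n0 [] /eqP + /eqP; rewrite !oppr_eq0 => /eqP ? /eqP ?;
      apply: n0; congr pair.
  by move=> /(_ n0); rewrite /pdet /=; lia.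
(* [v] and [pdet z0] are orthogonal coordinates along and across z0. On feasible points constraint i
   bounds [v] above, and j below, by a multiple of [pdet z0] with slope [K]. *)
pose N := z0.1 ^+ 2 + z0.2 ^+ 2.
pose v z := z0.1 * z.1 + z0.2 * z.2.
pose K k := `|N * w k| + `|b k * z0.1 - a k * z0.2|.
have formE k z : N * row_form k z = row_form k z0 * v z + (b k * z0.1 - a k * z0.2) * pdet z0 z.
  by rewrite /N /row_form /v /pdet; ring.
have N0 : 0 < N.
  rewrite lt_def addr_ge0 ?sqr_ge0 // andbT; apply/eqP => /eqP.
  rewrite paddr_eq0 ?sqr_ge0 // !sqrf_eq0 => /andP[/eqP h1 /eqP h2].
  by apply: z0n0; case: (z0) h1 h2 => /= ? ? -> ->.
have bound e x u k C : 1 <= e -> 1 <= u -> 0 <= C -> e * x <= C + k * u ->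
    x <= (`|C| + `|k|) * u :> int.
  move=> e1 u1 C0 h; have [x0|x0] := lerP x 0.
    by rewrite (le_trans x0) // mulr_ge0 // ?addr_ge0 //; lia.
  have : x <= e * x by nia.
  have : k * u <= `|k| * u by nia.
  have : C <= C * u by nia.
  by rewrite (ger0_norm C0) mulrDl; lia.
have vle z : feasible w z -> z <> (0, 0) -> v z <= K i * pdet z0 z.
  move=> hz zn0; apply: (bound (- row_form i z0)); first by have := w_ge0 i; lia.
  - by have := hz0 z hz zn0; lia.
  - by have := w_ge0 i; nia.
  by have := hz i; have := formE i z; nia.
have vge z : feasible w z -> z <> (0, 0) -> - v z <= K j * pdet z0 z.
  move=> hz zn0; apply: (bound (row_form j z0)); first by have := w_ge0 j; lia.
  - by have := hz0 z hz zn0; lia.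
  - by have := w_ge0 j; nia.
  by have := hz j; have := formE j z; nia.
(* Since s is at most 2, this M outweighs the term [s * v z] on feasible points; irrationality of s
   leaves only the zero 0. *)
pose M := (K i + K j) * 2 + 1; pose s : R := Num.sqrt 2.
exists (s * z0.1%:~R - M%:~R * z0.2%:~R, s * z0.2%:~R + M%:~R * z0.1%:~R).
have E z : functional (s * z0.1%:~R - M%:~R * z0.2%:~R, s * z0.2%:~R + M%:~R * z0.1%:~R) z
    = M%:~R * (pdet z0 z)%:~R + s * (v z)%:~R.
  by rewrite /functional /v /pdet /= rmorphB rmorphD !rmorphM /=; ring.
have K0 k : 0 <= K k by rewrite addr_ge0.
split=> z; rewrite E.
  move=> hz zn0; have u1 : 1 <= pdet z0 z by have := hz0 z hz zn0; lia.
  have s0 : 0 <= s := sqrtr_ge0 _.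
  have s2 : s <= 2.
    by have : s ^+ 2 = 2 := sqr_sqrtr (ler0n R 2); nra.
  have {}vge : - (K i + K j) * pdet z0 z <= v z.
    by have := vge z hz zn0; have := K0 i; nia.
  move: vge; rewrite -(ler_int R) rmorphM /= => vge.
  have -> : M%:~R = (K i + K j)%:~R * 2 + 1 :> R by rewrite rmorphD rmorphM.
  have : 0 <= (K i + K j)%:~R :> R by rewrite ler0z addr_ge0.
  move: u1; rewrite -(ler_int R).
  move: vge; rewrite rmorphN /=.
  move: ((K i + K j)%:~R : R) ((v z)%:~R : R) ((pdet z0 z)%:~R : R) => k vv u h1 h2 h3.
  have : 0 <= s * (vv + k * u) by rewrite mulr_ge0 //; lra.
  have : 0 <= (2 - s) * (k * u) by rewrite !mulr_ge0 //; lra.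
  lra.
move=> /eqP; rewrite addr_eq0 -mulrN -rmorphN -rmorphM /= => /eqP h.
have [h1 h2] := sqrt2_irrational h.
have M0 : M <> 0 by have := K0 i; have := K0 j; rewrite /M; lia.
have u0 : pdet z0 z = 0 by nia.
have : N * z.1 = 0.
  have -> : N * z.1 = z0.1 * v z - z0.2 * pdet z0 z by rewrite /N /v /pdet; ring.
  nia.
have : N * z.2 = 0.
  have -> : N * z.2 = z0.2 * v z + z0.1 * pdet z0 z by rewrite /N /v /pdet; ring.
  nia.
by case: (z) => x y /=; move: (N) N0 => N'; clear; move=> *; congr pair; nia.
Qed.

Definition comb (x y : int) p q : int * int :=
  (x * p.1 + y * q.1, x * p.2 + y * q.2).

Lemma form_comb k x y p q : row_form k (comb x y p q) = x * row_form k p + y * row_form k q.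
Proof. by rewrite /row_form /=; ring. Qed.

Lemma functional_comb c x y p q :
  functional c (comb x y p q) = x%:~R * functional c p + y%:~R * functional c q.
Proof. by rewrite /functional /= !rmorphD !rmorphM /=; ring. Qed.

(** Cramer's rule; [comb D 0 z z] is the multiple D z. *)
Lemma pdet_combE p q z : comb (pdet p q) 0 z z = comb (pdet z q) (pdet p z) p q.
Proof. by rewrite /comb /pdet; congr pair; ring. Qed.

Definition violator (c : R * R) i p :=
  [/\ feasible (relax i) p, row_form i p = - w i - 1 & functional c p < 0].

Lemma violator_form c i p k : violator c i p -> k != i -> - w k <= row_form k p.
Proof. by case=> /(_ k) + _ _ ki; rewrite /relax (negPf ki) addr0. Qed.

Lemma violator_form_gt c i p k : violator c i p -> - w k - 1 <= row_form k p.
Proof.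
by move=> v; have [->|/(violator_form v)] := eqVneq k i; [case: v => _ -> _|lia].
Qed.

Section Exposing.
Variable c : R * R.
Hypothesis c_pos : forall z, feasible w z -> z <> (0, 0) -> 0 < functional c z.
Hypothesis c_generic : forall z, functional c z = 0 -> z = (0, 0).

Lemma feasible_functional_ge0 z : feasible w z -> 0 <= functional c z.
Proof.
move=> hz; have [->|/eqP zn0] := eqVneq z (0, 0); last exact/ltW/c_pos.
by rewrite /functional /= !mulr0 addr0.
Qed.

(** As c fails for [relax i], some nonzero point has nonpositive value, negative by genericity. By
    integrality it lies on the boundary of constraint i, else it would be feasible for w. *)
Lemma violator_exists i : ~ origin_exposed (relax i) -> exists p, violator c i p.
Proof.
move=> ne; apply: contrapT => /forallNP h; apply: ne; exists c => z hz zn0.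
rewrite ltNge; apply/negP => cz; apply: (h z).
have {}cz : functional c z < 0.
  by rewrite lt_neqAle cz andbT; apply/eqP => /c_generic.
split=> //; apply/eqP; rewrite eq_le; apply/andP; split; last first.
  by have := hz i; rewrite /relax eqxx; lia.
rewrite leNgt; apply/negP => hi; move: cz; rewrite ltNge feasible_functional_ge0 //.
move=> k; have [->|ki] := eqVneq k i; first by lia.
by have := hz k; rewrite /relax (negPf ki); lia.
Qed.

(* A lattice triangle with vertices 0, p, q and area greater than 1/2 contains
   a further lattice point, which would be feasible. *)
Lemma pdet_violators i j p q :
  i != j -> violator c i p -> violator c j q -> `|pdet p q| = 1.
Proof.
move=> ij vp vq; have [_ pi cp] := vp; have [_ qj cq] := vq.
have [u [v huv]] := Bezoutz p.1 p.2.
have g0 : gcdz p.1 p.2 != 0.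
  apply/negP; rewrite gcdz_eq0 => /andP[/eqP x1 /eqP x2].
  by move: cp; rewrite /functional x1 x2 !mulr0 addr0 ltxx.
have [x1 hp1] : exists x1, p.1 = x1 * gcdz p.1 p.2 by apply/dvdzP; exact: dvdz_gcdl.
have [x2 hp2] : exists x2, p.2 = x2 * gcdz p.1 p.2 by apply/dvdzP; exact: dvdz_gcdr.
(* p is primitive: dividing it by g >= 2 would give a feasible point with negative value. *)
have g1 : gcdz p.1 p.2 = 1.
  have gge : 0 <= gcdz p.1 p.2 by [].
  move: (gcdz p.1 p.2) g0 gge hp1 hp2 {huv} => g g0 gge hp1 hp2.
  apply: contrapT => g1; have {g0 gge g1} g2 : 2 <= g by lia.
  have pE : p = comb g 0 (x1, x2) (x1, x2).
    by rewrite [p]surjective_pairing hp1 hp2 /comb /=; congr pair; ring.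
  have : functional c (x1, x2) < 0.
    move: cp; rewrite pE functional_comb mul0r addr0 pmulr_rlt0 // ltr0z; lia.
  rewrite ltNge feasible_functional_ge0 // => k.
  have := violator_form_gt k vp; rewrite pE form_comb.
  by have := w_ge0 k; nia.
have {huv x1 x2 hp1 hp2 g0 g1} [r hr] : exists r, pdet p r = 1.
  by exists (- v, u); rewrite /pdet /= -g1 -huv; ring.
(* If q were a multiple of p, the signs of c would make the factor positive, and q would violate
   constraint i as well. *)
have det0 : pdet p q <> 0.
  move=> d0; have := pdet_combE p r q; rewrite hr d0 => qE.
  have fE k : row_form k q = pdet q r * row_form k p.
    by have := congr1 (row_form k) qE; rewrite !form_comb !mul0r !addr0 mul1r.
  have cE : functional c q = (pdet q r)%:~R * functional c p.
    by have := congr1 (functional c) qE; rewrite !functional_comb mulr1z mulr0z !mul0r !addr0 mul1r.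
  have : 0 < pdet q r by rewrite -(ltr0z R) -(nmulr_llt0 _ cp) -cE.
  by have := violator_form vq ij; rewrite fE pi; have := w_ge0 i; nia.
have [m [s qE]] : exists m s, q = comb m `|pdet p q| p s.
  have := pdet_combE p r q; rewrite hr => qE.
  have {}qE : q = comb (pdet q r) (pdet p q) p r.
    by rewrite -qE /comb !mul1r !mul0r !addr0; case: (q).
  have [N0|N0] := lerP 0 (pdet p q).
    by exists (pdet q r), r; rewrite ger0_norm.
  exists (pdet q r), (- r.1, - r.2); rewrite ltr0_norm // {1}qE.
  by rewrite /comb /=; congr pair; ring.
have {det0 hr r} : 0 < `|pdet p q| by lia.
have [N NE] : exists N : int, N = `|pdet p q| by eexists.
rewrite -NE in qE *; move=> N0; apply: contrapT => N1 {NE}.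
(* With q = m p + N s, this residue makes q + e p divisible by N; the quotient z is the further
   lattice point. *)
pose e := modz (- m) N.
have e0 : 0 <= e by rewrite modz_ge0; lia.
have eN : e < N by rewrite ltz_pmod.
have [z zE] : exists z, comb N 0 z z = comb 1 e q p.
  exists (comb 1 (- divz (- m) N) s p).
  have -> : e = - m - divz (- m) N * N by have := divz_eq (- m) N; rewrite /e; lia.
  by rewrite qE /comb /=; congr pair; ring.
have cE : N%:~R * functional c z = functional c q + e%:~R * functional c p.
  by have := congr1 (functional c) zE; rewrite !functional_comb mulr1z mulr0z !mul0r !addr0 mul1r.
have fE k : N * row_form k z = row_form k q + e * row_form k p.
  by have := congr1 (row_form k) zE; rewrite !form_comb !mul0r !addr0 mul1r.
have : functional c z < 0.
  rewrite -(@pmulr_rlt0 _ N%:~R) ?ltr0z // cE.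
  by rewrite ltr_wnDr // mulr_ge0_le0 ?ler0z // ltW.
rewrite ltNge feasible_functional_ge0 // => k.
have wk := w_ge0 k; have := fE k.
have [ki|ki] := eqVneq k i.
  have := violator_form vq ij; rewrite -ki => hq; have := violator_form_gt k vp => hp.
  by nia.
have hp := violator_form vp ki; have hq := violator_form_gt k vq.
have [e00|e1] := eqVneq e 0.
  by rewrite e00 mul0r addr0; nia.
by nia.
Qed.

(** By Cramer's rule r is a combination of p and q with coefficients 1 or -1. Negativity of c
    excludes - p - q; the other signs are the three cases. *)
Lemma unimodular_triple p q r :
  functional c p < 0 -> functional c q < 0 -> functional c r < 0 ->
  `|pdet p q| = 1 -> `|pdet p r| = 1 -> `|pdet q r| = 1 ->
  [\/ r = comb 1 1 p q, p = comb 1 1 q r | q = comb 1 1 p r].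
Proof.
move=> cp cq cr pq pr qr; have := pdet_combE p q r.
have -> : pdet r q = - pdet q r by rewrite /pdet; ring.
have [e [f [rE e1 f1]]] : exists e f, [/\ comb (pdet p q) 0 r r =
    comb (- pdet q r) (pdet p r) p q -> r = comb e f p q, `|e| = 1 & `|f| = 1].
  exists (- (pdet p q) * pdet q r), (pdet p q * pdet p r); split; try nia.
  have d2 : pdet p q * pdet p q = 1 by nia.
  move=> h; have : comb (pdet p q) 0 (comb (pdet p q) 0 r r) r =
    comb (pdet p q) 0 (comb (- pdet q r) (pdet p r) p q) r by rewrite h.
  have -> : comb (pdet p q) 0 (comb (pdet p q) 0 r r) r = r.
    rewrite /comb /= !mul0r !addr0 !mulrA d2 !mul1r.
    by case: (r).
  by move=> {1}->; rewrite /comb /=; congr pair; ring.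
move=> /rE {}rE; have := congr1 (functional c) rE; rewrite functional_comb => cE.
have [e0|e0] : e = 1 \/ e = - 1 by lia.
all: have [f0|f0] : f = 1 \/ f = - 1 by lia.
- by constructor 1; rewrite rE e0 f0.
- by constructor 2; rewrite rE e0 f0 /comb; case: (p) => ? ? /=; congr pair; ring.
- by constructor 3; rewrite rE e0 f0 /comb; case: (q) => ? ? /=; congr pair; ring.
by move: cE; rewrite e0 f0 mulrN1z !mulN1r; lra.
Qed.

(** p misses constraint i by one while p + q satisfies it, so q contributes at least one. *)
Lemma violator_sum_form_gt0 i j p q :
  i != j -> violator c i p -> violator c j (comb 1 1 p q) -> 0 < row_form i q.
Proof.
move=> ij vp vs; have [_ pi _] := vp.
by have := violator_form vs ij; rewrite form_comb pi !mul1r; lia.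
Qed.

(* In the basis (p, q) the functional x - 2 y exposes the origin as soon as
   row_form k p > w k. *)
Lemma violator_sum_form_le i j k p q :
  i != j -> j != k -> i != k ->
  violator c i p -> violator c k q -> violator c j (comb 1 1 p q) ->
  ~ origin_exposed (relax i) -> row_form k p <= w k.
Proof.
move=> ij jk ik vp vq vs ne; rewrite leNgt; apply/negP => kp; apply: ne.
have [_ pi _] := vp; have [_ qk _] := vq; have [_ sj _] := vs.
have D1 := pdet_violators ik vp vq.
have D2 : pdet p q * pdet p q = 1 by nia.
have s0 := violator_sum_form_gt0 ij vp vs.
pose D : R := (pdet p q)%:~R.
(* Cramer's rule writes x - 2 y in standard coordinates; D is its own inverse. *)
exists (D * (q.2 + 2 * p.2)%:~R, - D * (q.1 + 2 * p.1)%:~R) => z hz zn0.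
pose x := pdet p q * pdet z q; pose y := pdet p q * pdet p z.
have zE : z = comb x y p q.
  have := congr1 (fun r => comb (pdet p q) 0 r r) (pdet_combE p q z).
  rewrite {1 2}/comb /= !mul0r !addr0 !mulrA D2 !mul1r -surjective_pairing => ->.
  by rewrite /comb /x /y; congr pair; rewrite /=; ring.
have -> : functional (D * (q.2 + 2 * p.2)%:~R, - D * (q.1 + 2 * p.1)%:~R) z =
    (x - 2 * y)%:~R.
  by rewrite /functional /D /x /y /pdet /= !(rmorphB, rmorphD, rmorphM) /=; ring.
rewrite ltr0z ltNge; apply/negP => xy.
move: {D} x y zE xy => x y zE xy.
have fE l : row_form l z = x * row_form l p + y * row_form l q by rewrite zE form_comb.
have jp := violator_form vp (_ : j != i); rewrite eq_sym in jp.
have {}jp := jp ij; have jq := violator_form vq jk.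
move: sj; rewrite form_comb !mul1r => sj.
have zi := hz i; have zj := hz j; have zk := hz k.
move: zi zj zk; rewrite /relax eqxx !fE pi qk.
rewrite ![_ == i]eq_sym (negPf ij) (negPf ik) /= addr0 => zi zj zk.
have wi := w_ge0 i; have wj := w_ge0 j; have wk := w_ge0 k.
(* Here x <= 2 y. Constraint j excludes x, y > 0, and k excludes x <= 0 < y. For x, y <= 0
   constraint k gives y <= x, hence x = y = 0. *)
have [x0|x0] := ltrP 0 x.
  have y0 : 0 < y by lia.
  nia.
have [y0|y0] := ltrP 0 y.
  nia.
have yx : y <= x by nia.
have x00 : x = 0 by lia.
have y00 : y = 0 by lia.
by apply: zn0; rewrite zE x00 y00 /comb !mul0r addr0.
Qed.

End Exposing.

Lemma planar_relaxation (T : {set I}) :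
  origin_exposed w -> (forall i, i \in T -> ~ origin_exposed (relax i)) ->
  (2 < #|T|)%N ->
  (exists z, forall i, i \in T -> 0 < row_form i z) /\
  (exists mu : I -> int, [/\ exists2 i, i \in T & mu i != 0,
     forall i, i \notin T -> mu i = 0 &
     forall z, \sum_i mu i * row_form i z = 0]).
Proof.
move=> /generic_exposing[c [cpos cgen]] ne cT.
have ex i (iT : i \in T) : exists p, violator c i p.
  exact: violator_exists cpos cgen _ (ne i iT).
have [i [j [k [[pi [pj [pk [vi vj vk sE]]]] [iT jT kT] [ij jk ki]]]]] : exists i j k,
    [/\ exists p q r, [/\ violator c i p, violator c j q, violator c k r & q = comb 1 1 p r],
        [/\ i \in T, j \in T & k \in T] & [/\ i != j, j != k & k != i]].
  have [i [j [k [[iT jT kT] [ij jk ki]]]]] := card_gt2P cT.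
  have [[p vp] [q vq] [r vr]] := And3 (ex i iT) (ex j jT) (ex k kT).
  have [_ _ cp] := vp; have [_ _ cq] := vq; have [_ _ cr] := vr.
  have ik : i != k by rewrite eq_sym.
  have [E|E|E] := unimodular_triple cp cq cr (pdet_violators cpos ij vp vq)
    (pdet_violators cpos ik vp vr) (pdet_violators cpos jk vq vr).
  - by exists i, k, j; split; [exists p, r, q|split|split; rewrite eq_sym].
  - by exists j, i, k; split; [exists q, p, r|split|split; rewrite // eq_sym].
  - by exists i, j, k; split; [exists p, q, r|split|split].
have ik : i != k by rewrite eq_sym.
rewrite sE in vj.
have D1 := pdet_violators cpos ik vi vk.
have T3 l : l \in T -> [|| l == i, l == j | l == k].
  (* For a fourth index, [pdet p pi], [pdet p pk] and their sum would all be 1 or -1, against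
     parity. *)
  move=> /ex[p vp]; apply/negPn; rewrite !negb_or; apply/and3P => -[li lj lk].
  have := pdet_violators cpos li vp vi; have := pdet_violators cpos lk vp vk.
  have := pdet_violators cpos lj vp vj.
  have -> : pdet p (comb 1 1 pi pk) = pdet p pi + pdet p pk.
    by rewrite /pdet /comb /=; ring.
  by lia.
have combC : comb 1 1 pi pk = comb 1 1 pk pi by rewrite /comb /=; congr pair; ring.
have vj' := vj; rewrite combC in vj'.
have kj : k != j by rewrite eq_sym.
have ji : j != i by rewrite eq_sym.
have [_ fii _] := vi; have [_ fkk _] := vk; have [_ fjs _] := vj.
have fki := violator_sum_form_le cpos ij jk ik vi vk vj (ne i iT).
have fik := violator_sum_form_le cpos kj ji ki vk vi vj' (ne k kT).
have fki0 := violator_sum_form_gt0 kj vk vj'.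
have fik0 := violator_sum_form_gt0 ij vi vj.
split.
  exists (comb (- 1) (- 1) pi pk) => l /T3/or3P[]/eqP->; rewrite form_comb !mulN1r.
  - by lia.
  - by move: fjs; rewrite form_comb; have := w_ge0 j; lia.
  - by lia.
(* The 2 by 2 minors of the rows (a, b) at i, j, k are the coefficients of a linear relation among
   the three forms. *)
pose mu l := if l == i then a j * b k - a k * b j
  else if l == j then a k * b i - a i * b k
  else if l == k then a i * b j - a j * b i else 0.
exists mu; split=> [|l lT|z].
- exists j => //; rewrite /mu (negPf ji) eqxx.
  (* Up to a unit, the coefficient at j is a product of factors in [1, w k] and [1, w i] minus (w k
     + 1)(w i + 1), hence nonzero. *)
  have : (a k * b i - a i * b k) * pdet pi pk =
      row_form k pi * row_form i pk - row_form k pk * row_form i pi.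
    by rewrite /row_form /pdet; ring.
  rewrite fii fkk; have := w_ge0 i; have := w_ge0 k.
  by move=> wk wi h; apply/eqP => h0; move: h; rewrite h0; nia.
- by rewrite /mu !ifN //; apply: contraNneq lT => ->.
rewrite (bigD1 i) // (bigD1 j) //= (bigD1 k) ?ki ?kj //= big1.
  by rewrite /mu eqxx (negPf ji) (negPf ki) (negPf kj) !eqxx /row_form; ring.
by move=> l /andP[/andP[li lj] lk]; rewrite /mu !ifN // mul0r.
Qed.

End Planar.

(** * Vertices of fibers and the primes of the vertex ideal *)

Section Vertices.
Variables (R : realType) (n : nat) (L : set 'cV[int]_n).
Hypothesis L_lattice : lattice L.

Lemma mnm_realE (u : 'X_{1..n}) : mnm_real R u = map_mx intr (mnm_int u).
Proof. by apply/colP => i; rewrite !mxE. Qed.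

Lemma map_intr_inj m p : injective (map_mx intr : 'M[int]_(m, p) -> 'M[R]_(m, p)).
Proof.
by move=> u v /matrixP uv; apply/matrixP => i j; have := uv i j; rewrite !mxE => /intr_inj.
Qed.

Definition steps (v : 'X_{1..n}) : set 'cV[int]_n :=
  [set z | L z /\ forall i, - (v i)%:Z <= z i 0].

Definition exposing (v : 'X_{1..n}) (c : 'rV[R]_n) : Prop :=
  forall z, steps v z -> z <> 0 -> 0 < (c *m map_mx intr z) 0 0.

Lemma mnm_of_step (v : 'X_{1..n}) (z : 'cV[int]_n) : (forall i, - (v i)%:Z <= z i 0) ->
  exists u : 'X_{1..n}, mnm_int u = mnm_int v + z.
Proof.
move=> hz; exists [multinom absz ((v i)%:Z + z i 0)%R | i < n].
by apply/colP => i; rewrite !mxE mnmE gez0_abs // -lerBlDl sub0r.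
Qed.

Lemma mem_fiber (u v : 'X_{1..n}) : L (mnm_int v - mnm_int u) -> fiber L v (mnm_real R u).
Proof.
move=> Luv; exists 1, (fun=> 1), (fun=> mnm_real R u).
by split=> //; [move=> _; exists u|rewrite big_ord1|rewrite big_ord1 scale1r].
Qed.

(** Each step from v ends at a lattice point of the fiber, so a functional cutting out v is positive
    on nonzero steps. Conversely, a convex combination attaining the minimum has all its weight on
    v. *)
Lemma vertexP (v : 'X_{1..n}) :
  is_vertex (mnm_real R v) (fiber L v) <-> exists c, exposing v c.
Proof.
split=> [[c [b [cle ceq]]]|[c ec]].
  exists c => z [Lz hz] zn0; have [u uE] := mnm_of_step hz.
  have fu : fiber L v (mnm_real R u).
    by apply: mem_fiber; rewrite uE opprD addrA subrr sub0r; apply: latticeN.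
  have cv : (c *m mnm_real R v) 0 0 = b.
    have : [set mnm_real R v] (mnm_real R v) by [].
    by rewrite ceq => -[].
  have cu : (c *m mnm_real R u) 0 0 = b + (c *m map_mx intr z) 0 0.
    by rewrite mnm_realE uE map_mxD -mnm_realE mulmxDr mxE cv.
  have := cle _ fu; rewrite cu lerDl le_eqVlt => /orP[/eqP z0|//].
  have : [set mnm_real R v] (mnm_real R u) by rewrite ceq; split; rewrite // cu -z0 addr0.
  rewrite /= !mnm_realE => /map_intr_inj; rewrite uE => /(canRL (addKr _)).
  by rewrite addNr => z00; case: zn0.
pose b := (c *m mnm_real R v) 0 0.
have key x : [set mnm_real R u | u in [set u | L (mnm_int v - mnm_int u)]] x ->
    b <= (c *m x) 0 0 /\ ((c *m x) 0 0 = b -> x = mnm_real R v).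
  move=> [u /= Luv <-].
  have -> : (c *m mnm_real R u) 0 0 =
      b + (c *m map_mx intr (mnm_int u - mnm_int v)) 0 0.
    by rewrite map_mxB -!mnm_realE mulmxBr !mxE; rewrite /b mxE; ring.
  have [uv|/eqP un] := eqVneq (mnm_int u) (mnm_int v).
    by rewrite !mnm_realE uv subrr map_mx0 mulmx0 mxE addr0.
  have : 0 < (c *m map_mx intr (mnm_int u - mnm_int v)) 0 0.
    apply: ec; last by move/eqP; rewrite subr_eq0 => /eqP.
    split=> [|i]; first by rewrite -opprB; apply: latticeN.
    by rewrite !mxE; lia.
  by move=> h; split=> [|/eqP]; rewrite ?lerDl ?ltW // -subr_eq0 addrC addKr gt_eqF.
have expand m (w : 'I_m -> R) (x : 'I_m -> 'cV[R]_n) : \sum_i w i = 1 ->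
    (c *m \sum_i w i *: x i) 0 0 - b = \sum_i w i * ((c *m x i) 0 0 - b).
  move=> w1; rewrite mulmx_sumr summxE -{1}[b]mul1r -w1 mulr_suml -sumrB.
  by apply: eq_bigr => i _; rewrite -scalemxAr mxE mulrBr.
exists c, b; split=> [x [m [w [x' [Xx w0 w1 ->]]]]|].
  rewrite -subr_ge0 expand // sumr_ge0 // => i _.
  by rewrite mulr_ge0 // subr_ge0; case: (key _ (Xx i)).
apply/seteqP; split=> [x ->|x [[m [w [x' [Xx w0 w1 ->]]]]]].
  by split=> //; apply: mem_fiber; rewrite subrr; apply: L_lattice.1.
move=> /eqP; rewrite -subr_eq0 expand // psumr_eq0 => [/allP h|i _]; last first.
  by rewrite mulr_ge0 // subr_ge0; case: (key _ (Xx i)).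
rewrite /= -[RHS]scale1r -w1 scaler_suml; apply: eq_bigr => i _.
have := h i (mem_index_enum _); rewrite mulf_eq0 subr_eq0.
case/orP=> [/eqP->|/eqP e]; first by rewrite !scale0r.
by have [_ /(_ e) ->] := key _ (Xx i).
Qed.

Definition nonvertex (v : 'X_{1..n}) := ~ is_vertex (mnm_real R v) (fiber L v).

(** Steps from v are steps from u + v, so v inherits any exposing functional. *)
Lemma nonvertexD (u v : 'X_{1..n}) : nonvertex v -> nonvertex (u + v)%MM.
Proof.
move=> nv /vertexP[c ec]; apply: nv; apply/vertexP; exists c => z [Lz hz].
by apply: ec; split=> // i; rewrite mnmDE; have := hz i; lia.
Qed.

(** v is the midpoint of v + z and v - z. *)
Lemma nonvertex_opp z (v : 'X_{1..n}) : z <> 0 -> steps v z -> steps v (- z) -> nonvertex v.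
Proof.
move=> z0 hz hNz /vertexP[c ec]; have := ec _ hz z0.
have Nz0 : - z <> 0 by move/eqP; rewrite oppr_eq0 => /eqP.
by have := ec _ hNz Nz0; rewrite map_mxN mulmxN mxE; lra.
Qed.

Variable k : fieldType.

Lemma mem_vertex_ideal (p : {mpoly k[n]}) :
  vertex_ideal k R L p <-> forall m, m \in msupp p -> nonvertex m.
Proof.
split=> [[m [c [g [hg ->]]]] u|hp].
  move/msupp_sum_le/flatten_mapP => [i _].
  have [v [nv ->]] := hg i.
  by rewrite (perm_mem (msuppMX _ _)) => /mapP[u' _ ->]; rewrite addmC; apply: nonvertexD.
pose s := msupp p.
exists (size s), (fun i => (p@_(tnth (in_tuple s) i))%:MP), (fun i => 'X_[tnth (in_tuple s) i]).
split=> [i|]; first by exists (tnth (in_tuple s) i); split=> //; apply: hp; apply: mem_tnth.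
rewrite {1}[p]mpolyE (big_tnth _ _ (msupp p)) /=.
by apply: eq_bigr => i _; rewrite mul_mpolyC.
Qed.

End Vertices.

(** * Associated primes of the vertex ideal, and passage to the plane *)

Section VertexIdealPrimes.
Variables (R : realType) (k : fieldType) (n : nat) (L : set 'cV[int]_n).
Hypothesis L_lattice : lattice L.

Let memV (p : {mpoly k[n]}) :
  vertex_ideal k R L p <-> forall m, m \in msupp p -> nonvertex R L m.
Proof. exact: mem_vertex_ideal. Qed.

Lemma mem_coord_prime (tau : {set 'I_n}) i :
  coord_prime k tau 'X_i <-> i \notin tau.
Proof.
split=> [|it]; last by apply: ideal_gen_mem; exists i.
move=> [m [c [g [hg e]]]].
have : U_(i)%MM \in msupp ('X_i : {mpoly k[n]}) by rewrite msuppX inE.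
rewrite e => /msupp_sum_le/flatten_mapP[l _].
have [j /= jt <-] := hg l.
rewrite (perm_mem (msuppMX _ _)) => /mapP[u _ /mnmP/(_ j)].
rewrite mnmDE !mnm1E eqxx; case: eqP => [-> //|]; lia.
Qed.

(** As f is outside the ideal, some monomial w of f is a vertex; multiplying f by a variable only
    shifts its support. *)
Lemma associated_coord_prime (tau : {set 'I_n}) :
  associated_prime (vertex_ideal k R L) (coord_prime k tau) ->
  exists w, ~ nonvertex R L w /\ forall i, i \notin tau -> nonvertex R L (w + U_(i))%MM.
Proof.
move=> [hP [f fE]].
have [w [wf nw]] : exists w, w \in msupp f /\ ~ nonvertex R L w.
  apply: contrapT => no; apply: (prime_ideal1 hP); rewrite fE /colon /= mul1r.
  apply/memV => m mf; apply: contrapT => nm.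
  by apply: no; exists m.
exists w; split=> // i /mem_coord_prime; rewrite fE /colon /= mulrC.
move/memV; apply; rewrite (perm_mem (msuppMX _ _)).
by apply/mapP; exists w; rewrite // addmC.
Qed.

(** Take a nonzero u in L with coordinate i zero. The monomial with exponents |u| is the midpoint of
    its translates by u and - u, so it lies in Q, and so does one of its variables. *)
Lemma associated_prime_variable (Q : set {mpoly k[n]}) i :
  rank_ge L 2 -> associated_prime (vertex_ideal k R L) Q ->
  exists2 j, j != i & Q 'X_j.
Proof.
move=> r2 [hQ [f fE]].
have VQ p : vertex_ideal k R L p -> Q p.
  move/memV => hp; rewrite fE /colon /=.
  apply/memV => m /msuppM_le/allpairsP[[u v] [/= up _ ->]].
  by rewrite addmC; apply: (nonvertexD L_lattice); apply: hp.
have [|u [Lu u0 ui]] := r2 [set i]%SET; first by rewrite cards1.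
pose v := [multinom absz (u l 0)%R | l < n].
have : Q 'X_[v].
  apply/VQ/memV => m; rewrite msuppX inE => /eqP->.
  have Nu : steps L v (- u).
    by split=> [|l]; [apply: latticeN|rewrite mnmE mxE abszE lerN2 ler_norm].
  by apply: (nonvertex_opp L_lattice u0) => //; split=> // l; rewrite mnmE abszE lerNl -normrN ler_norm.
rewrite mpolyXE_id => /(prime_ideal_prod hQ)[j /(prime_ideal_exp hQ)[Qj vj]].
exists j => //; apply/eqP => ji; apply: vj.
by rewrite mnmE ji ui // inE.
Qed.

(** The smaller prime Q contains two distinct variables; with at most two indices outside tau these
    would generate all of P. *)
Lemma embedded_coord_prime (tau : {set 'I_n}) :
  rank_ge L 2 -> embedded_prime (vertex_ideal k R L) (coord_prime k tau) ->
  (2 < #|~: tau|)%N.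
Proof.
move=> r2 [_ [Q aQ [QP nPQ]]].
have [|u [_ /eqP/matrix0Pn[i0 _] _]] := r2 finset.set0; first by rewrite cards0.
have [i _ Qi] := associated_prime_variable i0 r2 aQ.
have [j ji Qj] := associated_prime_variable i r2 aQ.
rewrite ltnNge; apply/negP => c2; apply: nPQ; apply: ideal_gen_sub; first by case: aQ.
have it : i \notin tau by apply/mem_coord_prime/QP.
have jt : j \notin tau by apply/mem_coord_prime/QP.
have E : [set i; j]%SET = ~: tau.
  apply/eqP; rewrite eqEcard cards2 eq_sym ji c2 andbT.
  by apply/fintype.subsetP => l; rewrite !inE => /orP[]/eqP->.
move=> p [l /= lt <-]; have : l \in ~: tau by rewrite inE.
by rewrite -E !inE => /orP[]/eqP->.
Qed.

Section Basis.
Variables g h : 'cV[int]_n.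
Hypotheses (Lg : L g) (Lh : L h).
Hypothesis gen : forall u, L u -> exists x y, u = x *: g + y *: h.
Hypothesis free : forall x y, x *: g + y *: h = 0 -> x = 0 /\ y = 0.

Let a i := g i 0.
Let b i := h i 0.

Lemma basis_minor : exists i j, a i * b j - a j * b i != 0.
Proof.
apply: contrapT => no.
have eq0 i j : a i * b j - a j * b i = 0.
  by apply/eqP/negPn/negP => ne; apply: no; exists i, j.
have g0 : g != 0.
  by apply/eqP => g0; have [|] := free (x := 1) (y := 0); rewrite // g0 scale1r scale0r addr0.
have /matrix0Pn[i [l gi]] := g0; rewrite (ord1 l) in gi.
have [|_ /eqP] := free (x := - b i) (y := a i); last by rewrite (negPf gi).
by apply/colP => j; rewrite !mxE; rewrite -[RHS](eq0 i j) /a /b; ring.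
Qed.

Lemma exposing_in_basis (v : 'X_{1..n}) :
  (exists c : 'rV[R]_n, exposing L v c) <-> origin_exposed R a b (fun i => (v i)%:Z).
Proof.
have cE (c : 'rV[R]_n) x y : (c *m map_mx intr (x *: g + y *: h)) 0 0 =
    (c *m map_mx intr g) 0 0 * x%:~R + (c *m map_mx intr h) 0 0 * y%:~R.
  have -> : map_mx intr (x *: g + y *: h) = x%:~R *: map_mx intr g + y%:~R *: map_mx intr h :> 'cV[R]_n.
    by apply/colP => i; rewrite !mxE rmorphD !rmorphM.
  by rewrite mulmxDr -!scalemxAr !mxE; ring.
have formE x y i : row_form a b i (x, y) = (x *: g + y *: h) i 0.
  by rewrite /row_form !mxE /=; rewrite /a /b; ring.
split=> [[c ec]|[[al be] hc]].
  exists ((c *m map_mx intr g) 0 0, (c *m map_mx intr h) 0 0) => -[x y] hz zn0.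
  rewrite /functional /= -cE; apply: ec => [|e].
    split=> [|i]; last by rewrite -formE.
    by apply: (latticeD L_lattice); apply: (latticeZ _ L_lattice).
  by have [x0 y0] := free e; apply: zn0; rewrite x0 y0.
have [i [j ij]] := basis_minor.
pose D : R := (a i * b j - a j * b i)%:~R.
have D0 : D != 0 by rewrite intr_eq0.
(* A functional supported on coordinates i and j takes the values al on g and be on h, by Cramer's
   rule with the nonzero minor D. *)
pose c : 'rV[R]_n := ((al * (b j)%:~R - be * (a j)%:~R) / D) *: delta_mx 0 i
  + ((be * (a i)%:~R - al * (b i)%:~R) / D) *: delta_mx 0 j.
have cz (z : 'cV[int]_n) : (c *m map_mx intr z) 0 0 =
    (al * (b j)%:~R - be * (a j)%:~R) / D * (z i 0)%:~R +
    (be * (a i)%:~R - al * (b i)%:~R) / D * (z j 0)%:~R.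
  by rewrite mulmxDl -!scalemxAl -!rowE !mxE.
have DE : D = (a i)%:~R * (b j)%:~R - (a j)%:~R * (b i)%:~R by rewrite /D rmorphB !rmorphM.
have cg : (c *m map_mx intr g) 0 0 = al.
  by rewrite cz -/(a i) -/(a j); apply: (mulIf D0); rewrite [in RHS]DE; field; rewrite -DE.
have ch : (c *m map_mx intr h) 0 0 = be.
  by rewrite cz -/(b i) -/(b j); apply: (mulIf D0); rewrite [in RHS]DE; field; rewrite -DE.
exists c => z [Lz hz] z0; have [x [y zE]] := gen Lz.
rewrite zE cE cg ch; apply: (hc (x, y)) => [l|[x0 y0]]; first by rewrite formE -zE.
by apply: z0; rewrite zE x0 y0 !scale0r addr0.
Qed.

Lemma vertex_relaxation (S : {set 'I_n}) (w : 'X_{1..n}) :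
  ~ nonvertex R L w -> (forall i, i \in S -> nonvertex R L (w + U_(i))%MM) ->
  (2 < #|S|)%N ->
  (exists2 z, L z & forall i, i \in S -> 0 < z i 0) /\
  exists mu : 'rV[int]_n, [/\ exists2 i, i \in S & mu 0 i != 0,
    forall i, i \notin S -> mu 0 i = 0 & forall z, L z -> mu *m z = 0].
Proof.
move=> /contrapT/(vertexP R L_lattice)/exposing_in_basis vw nv S2.
have nv' i : i \in S -> ~ origin_exposed R a b (relax (fun i => (w i)%:Z) i).
  have -> : relax (fun i => (w i)%:Z) i = fun l => ((w + U_(i))%MM l)%:Z.
    by apply/funext => l; rewrite /relax mnmDE mnm1E eq_sym PoszD.
  by move=> iS /exposing_in_basis/(vertexP R L_lattice); apply: nv.
have [//|[z hz] [mu [mu1 mu2 mu3]]] := planar_relaxation _ vw nv' S2.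
split.
  exists (z.1 *: g + z.2 *: h).
    by apply: (latticeD L_lattice); apply: (latticeZ _ L_lattice).
  by move=> i /hz; rewrite /row_form !mxE [a i * _]mulrC [b i * _]mulrC.
exists (\row_i mu i); split=> [|i iS|z' /gen[x [y ->]]].
- by case: mu1 => i iS mui; exists i; rewrite ?mxE.
- by rewrite mxE mu2.
apply/matrixP => r s; rewrite (ord1 r) (ord1 s) !mxE -[RHS](mu3 (x, y)).
by apply: eq_bigr => i _; rewrite !mxE /row_form /= /a /b; ring.
Qed.

End Basis.
End VertexIdealPrimes.


(** * Faces of the cone *)

Section Faces.
Variables (d n : nat) (A : 'M[int]_(d, n)).

Lemma clear_denominators m (x : 'cV[rat]_m) :
  exists2 N : int, N != 0 & exists y : 'cV[int]_m, N%:~R *: x = map_mx intr y.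
Proof.
exists (\prod_i denq (x i 0)); first by apply/prodf_neq0 => i _; apply: denq_neq0.
exists (\col_i (numq (x i 0) * \prod_(l | l != i) denq (x l 0))).
apply/colP => i; rewrite !mxE (bigD1 i) //= !intrM numqE; ring.
Qed.

(** Over the rationals, membership in the row space is tested on the cokernel; its columns, cleared
    of denominators, lie in the kernel lattice. *)
Lemma annihilator_row_space (R : realType) (mu : 'rV[int]_n) :
  (forall z, ker_lattice A z -> mu *m z = 0) ->
  exists y : 'rV[R]_d, map_mx intr mu = y *m map_mx intr A.
Proof.
move=> mu0; pose AQ : 'M[rat]_(d, n) := map_mx intr A.
have : (map_mx intr mu <= AQ)%MS.
  rewrite submxE; apply/eqP/matrixP => i j.
  pose x := col j (cokermx AQ).
  have [N N0 [z zE]] := clear_denominators x.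
  have Az : ker_lattice A z.
    have : map_mx intr (A *m z) = 0 :> 'cV[rat]_d.
      rewrite map_mxM -zE -scalemxAr /x colE mulmxA mulmx_coker mul0mx.
      by rewrite scaler0.
    by move/matrixP => h; apply/matrixP => a b; move: (h a b); rewrite !mxE => /eqP;
      rewrite intr_eq0 => /eqP.
  have := mu0 z Az; move/(congr1 (map_mx (intr : int -> rat))).
  rewrite map_mxM -zE -scalemxAr map_mx0 => /eqP; rewrite scaler_eq0 intr_eq0 (negPf N0).
  by rewrite /x colE mulmxA -colE => /eqP/matrixP/(_ i 0); rewrite !mxE.
move=> /submxP[y yE]; exists (map_mx ratr y).
have ratr_intr m p (B : 'M[int]_(m, p)) : map_mx ratr (map_mx intr B : 'M[rat]_(m, p)) = map_mx intr B :> 'M[R]_(m, p).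
  by apply/matrixP => i j; rewrite !mxE ratr_int.
by rewrite -ratr_intr yE map_mxM ratr_intr.
Qed.

(* A face functional c kills A z, so it vanishes on all columns and the face
   is the whole cone; writing a_j as a combination of the columns in tau then
   contradicts mu. *)
Lemma cone_not_face (R : realType) (tau : {set 'I_n}) (z : 'cV[int]_n) (mu : 'rV[int]_n) j :
  ker_lattice A z -> (forall i, i \notin tau -> 0 < z i 0) ->
  (forall u, ker_lattice A u -> mu *m u = 0) ->
  (forall i, i \in tau -> mu 0 i = 0) -> mu 0 j != 0 ->
  ~ is_face (cone_of_columns R A tau) (cone_of_columns R A [set: 'I_n]%SET).
Proof.
move=> Az zpos mu0 mutau muj [c [b [cle ceq]]].
have [y yE] := annihilator_row_space R mu0.
have rowcol (r : 'rV[R]_d) i : (r *m col i (map_mx intr A)) 0 0 = (r *m map_mx intr A) 0 i.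
  by rewrite colE mulmxA -colE mxE.
have col_cone (S : {set 'I_n}) i : i \in S -> cone_of_columns R A S (col i (map_mx intr A)).
  move=> iS; exists (fun l => (l == i)%:R); split=> [l|]; first exact: ler0n.
  rewrite (bigD1 i) //= eqxx scale1r big1 ?addr0 // => l /andP[_ /negPf->].
  by rewrite scale0r.
have b0 : b = 0.
  have : cone_of_columns R A tau 0.
    by exists (fun=> 0); split=> //; rewrite big1 // => i _; rewrite scale0r.
  by rewrite ceq /= mulmx0 mxE => -[_ <-].
have e0 i : 0 <= (c *m map_mx intr A) 0 i.
  by rewrite -b0 -rowcol; apply/cle/col_cone; rewrite inE.
have etau i : i \in tau -> (c *m map_mx intr A) 0 i = 0.
  by move=> /col_cone; rewrite ceq /= rowcol b0 => -[].
have : \sum_i (c *m map_mx intr A) 0 i * (z i 0)%:~R = 0.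
  transitivity ((c *m map_mx intr A *m map_mx intr z) 0 0).
    by rewrite [RHS]mxE; apply: eq_bigr => i _; congr (_ * _); rewrite mxE.
  by rewrite -mulmxA -map_mxM Az map_mx0 mulmx0 mxE.
move=> /eqP; rewrite psumr_eq0 => [/allP eall|i _]; last first.
  have [it|it] := boolP (i \in tau); first by rewrite etau // mul0r.
  by rewrite mulr_ge0 // ler0z ltW // zpos.
have ej : (c *m map_mx intr A) 0 j = 0.
  have [/etau//|jt] := boolP (j \in tau).
  have := eall j (mem_index_enum _); rewrite mulf_eq0 intr_eq0 => /orP[/eqP//|].
  by rewrite gt_eqF // zpos.
have : cone_of_columns R A tau (col j (map_mx intr A)).
  by rewrite ceq /= rowcol b0; split=> //; apply: col_cone; rewrite inE.
move=> [w [_ /(congr1 (fun v => (y *m v) 0 0))]].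
rewrite rowcol -yE mulmx_sumr summxE big1 ?mxE => [/eqP|i it].
  by rewrite intr_eq0 (negPf muj).
by rewrite -scalemxAr mxE rowcol -yE mxE mutau // mulr0.
Qed.

End Faces.

Theorem theorem3p11 (R : realType) (k : fieldType) (d n : nat)
    (A : 'M[int]_(d, n))
    (hcodim : codimension (lattice_ideal k (ker_lattice A)) 2)
    (hpos : ker_lattice A `&` nonneg_orthant n = [set 0]) :
  (forall tau : {set 'I_n},
     embedded_prime (vertex_ideal k R (ker_lattice A)) (coord_prime k tau) ->
     ~ is_face (cone_of_columns R A tau) (cone_of_columns R A [set: 'I_n]%SET))
  /\ ~ associated_prime (vertex_ideal k R (ker_lattice A))
         (coord_prime k (finset.set0 : {set 'I_n})).
Proof.
have hL := ker_lattice_lattice A.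
have [r2 r3] := codimension2_rank hcodim.
have [g [h [Lg Lh gen free]]] := rank2_basis hL r2 r3.
split=> [tau etau|assoc].
  have tau3 := embedded_coord_prime hL r2 etau.
  have [w [vw nv]] := associated_coord_prime hL etau.1.
  have [|[z Az zpos] [mu [[j _ muj] mutau mu0]]] :=
      vertex_relaxation hL Lg Lh gen free vw _ tau3.
    by move=> i; rewrite inE; apply: nv.
  apply: (cone_not_face Az _ mu0 _ muj) => i it; first by apply: zpos; rewrite inE.
  by apply: mutau; rewrite inE it.
have pos0 z : ker_lattice A z -> (forall i, 0 <= z i 0) -> z = 0.
  by move=> Az z0; have : [set 0] z by rewrite -hpos; split.
(* With at most two variables, a nonzero v in the lattice with a zero coordinate lies on an axis, so
   v or - v is nonnegative. *)
have n3 : (2 < #|[set: 'I_n]%SET|)%N.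
  rewrite cardsT card_ord ltnNge; apply/negP => n2.
  have [|u [Au u0 _]] := r2 finset.set0; first by rewrite cards0.
  have /matrix0Pn[i _] : u != 0 by apply/eqP.
  have [|v [Av v0 vi]] := r2 [set i]%SET; first by rewrite cards1.
  have /matrix0Pn[j [l vj]] : v != 0 by apply/eqP.
  rewrite (ord1 l) {l} in vj.
  have vl l : l != j -> v l 0 = 0.
    move=> lj; apply: (vi); rewrite inE; apply/negPn/negP => li.
    have ij : i != j by apply: contraNneq vj => <-; rewrite vi // inE.
    have : (#|[set l; i; j]%SET| <= n)%N by rewrite -[X in (_ <= X)%N]card_ord max_card.
    by rewrite -finset.setUA cardsU1 cards2 !inE (negPf li) (negPf lj) ij; lia.
  have [vj0|vj0] := lerP 0 (v j 0).
    apply: v0; apply: pos0 => // l; have [->//|/vl->//] := eqVneq l j.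
  have : - v = 0.
    apply: pos0 => [|l]; first exact: latticeN.
    by rewrite mxE; have [->|/vl->] := eqVneq l j; [rewrite oppr_ge0 ltW|rewrite oppr0].
  by move/eqP; rewrite oppr_eq0 => /eqP.
have [w [vw nv]] := associated_coord_prime hL assoc.
have [|[z Az zpos] _] := vertex_relaxation hL Lg Lh gen free vw _ n3.
  by move=> i _; apply: nv; rewrite inE.
have z0 : z = 0 by apply: pos0 => // i; rewrite ltW // zpos // inE.
have /card_gt0P[i _] := ltnW (ltnW n3).
by have := zpos i; rewrite z0 mxE inE ltxx => /(_ isT).
Qed.
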